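(* Let $\tau>0$, $\upsilon>0$, $T>0$, $L\in\mathbb{R}$, $a_1,a_2\in\mathbb{R}$ with $a_2\neq 0$, and consider the reaction-diffusion equation with constant time delay $$\partial_t u-\upsilon^2\partial_{xx}u+a_1u(x,t)+a_2u(x,t-\tau)=f(x,t),\quad (x,t)\in\mathbb{R}\times(0,T),$$ with $u=u_0$ on $\mathbb{R}\times[-\tau,0]$ and $u(\pm\infty,t)=0$ for $t\in(0,T)$. Consider the Dirichlet-Neumann waveform relaxation (DNWR) error iteration with relaxation parameter $\theta$ for this problem on the two subdomains $\Omega_1=(-\infty,L)$ and $\Omega_2=(L,\infty)$, started from an admissible initial interface error $h^0$. Then: (i) for $0<\theta<1$, $\theta\neq 1/2$, the DNWR iteration converges linearly; (ii) for $\theta=1/2$, the DNWR iteration converges within two iterations, for every time window length $T>0$.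
   Context: DNWR error iteration. Since the problem is linear, the iteration is written for the error, i.e. with $f=0$ and $u_0=0$. Given $h^0:[0,T]\to\mathbb{R}$ (initial error on the interface $\{x=L\}$), for $k=1,2,\dots$ let $e_1^k$ solve the Dirichlet problem $$\partial_t e_1^k-\upsilon^2\partial_{xx}e_1^k+a_1e_1^k(x,t)+a_2e_1^k(x,t-\tau)=0 \text{ in }\Omega_1\times(0,T),$$ $$e_1^k=0\text{ on }\Omega_1\times[-\tau,0],\quad e_1^k(-\infty,t)=0,\quad e_1^k(L,t)=h^{k-1}(t),\ t\in(0,T);$$ then let $e_2^k$ solve the Neumann problem $$\partial_t e_2^k-\upsilon^2\partial_{xx}e_2^k+a_1e_2^k(x,t)+a_2e_2^k(x,t-\tau)=0 \text{ in }\Omega_2\times(0,T),$$ $$e_2^k=0\text{ on }\Omega_2\times[-\tau,0],\quad \partial_xe_2^k(L,t)=\partial_xe_1^k(L,t),\quad e_2^k(\infty,t)=0,\ t\in(0,T);$$ and update $h^k(t)=\theta e_2^k(L,t)+(1-\theta)h^{k-1}(t)$. Regularity conventions. Solutions are classical: continuous on $\overline{\Omega_i}\times[-\tau,T]$, with $\partial_x e_i^k$ continuous on $\overline{\Omega_i}\times[0,T]$, and $\partial_t e_i^k,\partial_{xx}e_i^k$ continuous on $\Omega_i\times(0,T)$. Conditions at $\pm\infty$ mean convergence to $0$ as $x\to\pm\infty$, uniformly in $t\in(0,T)$. An initial interface error $h^0$ is admissible if it is continuous on $[0,T]$ and all iterates $e_i^k$ exist as such classical solutions. Convergence. Let $\|h\|=\sup_{t\in[0,T]}|h(t)|$.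 The iteration converges linearly if, for every admissible $h^0\not\equiv0$, there is $\rho\in(0,1)$ with $h^{k}\not\equiv 0$ for all $k$ and $\lim_{k\to\infty}\|h^{k}\|/\|h^{k-1}\|=\rho$ (so in particular $h^k\to0$). It converges within two iterations if, for every admissible $h^0$, the errors $e_1^k$, $e_2^k$ and $h^k$ vanish identically for all $k\ge2$. *)

(* Defs.v *)
From mathcomp Require Import all_boot all_order all_algebra.
From mathcomp Require Import all_classical all_reals all_analysis.
Import Order.TTheory GRing.Theory Num.Theory.
Import numFieldNormedType.Exports.

Set Implicit Arguments.
Unset Strict Implicit.
Unset Printing Implicit Defensive.

Local Open Scope classical_set_scope.
Local Open Scope ring_scope.

(* Functions of (x, t) are total functions [e : R -> R -> R] written [e x t];
   nothing is assumed about their values outside the space-time domains named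
   below. *)

(* Derivative relative to [D]: the usual derivative at an interior point of
   [D], the one-sided derivative at the endpoint of a half-line [D]. *)
Definition diff_quotient (R : realType) (f : R -> R) (x y : R) : R :=
  (f y - f x) / (y - x).

Definition derivable_within (R : realType) (D : set R) (f : R -> R) (x : R) :
    Prop :=
  cvg (diff_quotient f x y @[y --> within D x^']).

Definition derive_within (R : realType) (D : set R) (f : R -> R) (x : R) : R :=
  lim (diff_quotient f x y @[y --> within D x^']).

(* As functions of (x, t); [dx] lives on the closure of [O], the other two on
   the open set [O]. *)
Definition dx (R : realType) (O : set R) (e : R -> R -> R) (x t : R) : R :=
  derive_within (closure O) (e ^~ t) x.

Definition dt (R : realType) (e : R -> R -> R) (x t : R) : R := derive1 (e x) t.

Definition dxx (R : realType) (e : R -> R -> R) (x t : R) : R :=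
  derive1n 2 (e ^~ t) x.

(* Classical regularity. The derivability fields are needed because
   [derive_within] and [derive1] are total. *)
Record classical (R : realType) (tau T : R) (O : set R) (e : R -> R -> R) :
    Prop := Classical {
  classical_cont : {within closure O `*` `[- tau, T]%classic,
    continuous (fun z : R * R => e z.1 z.2)};
  classical_dx : forall x t : R, closure O x -> 0 <= t <= T ->
    derivable_within (closure O) (e ^~ t) x;
  classical_dx_cont : {within closure O `*` `[0, T]%classic,
    continuous (fun z : R * R => dx O e z.1 z.2)};
  classical_dt : forall x t : R, O x -> 0 < t < T -> derivable (e x) t 1;
  classical_dt_cont : {within O `*` `]0, T[%classic,
    continuous (fun z : R * R => dt e z.1 z.2)};
  classical_dxx : forall x t : R, O x -> 0 < t < T ->
    derivable (derive1 (e ^~ t)) x 1;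
  classical_dxx_cont : {within O `*` `]0, T[%classic,
    continuous (fun z : R * R => dxx e z.1 z.2)}
}.

(* [F] is [-oo] or [+oo]. *)
Definition vanishes_at (R : realType) (T : R) (F : set_system R)
    (e : R -> R -> R) : Prop :=
  forall eps : R, 0 < eps ->
    \forall x \near F, forall t : R, 0 < t < T -> `|e x t| < eps.

Record delay_rd_solution (R : realType) (tau v T a1 a2 : R) (O : set R)
    (F : set_system R) (e : R -> R -> R) : Prop := DelayRDSolution {
  sol_classical : classical tau T O e;
  sol_pde : forall x t : R, O x -> 0 < t < T ->
    dt e x t - v ^+ 2 * dxx e x t + a1 * e x t + a2 * e x (t - tau) = 0;
  sol_history : forall x t : R, O x -> - tau <= t <= 0 -> e x t = 0;
  sol_infinity : vanishes_at T F e
}.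

Definition Omega1 (R : realType) (L : R) : set R := `]-oo, L[%classic.
Definition Omega2 (R : realType) (L : R) : set R := `]L, +oo[%classic.

Definition dirichlet_solution (R : realType) (tau v T L a1 a2 : R)
    (h : R -> R) (e1 : R -> R -> R) : Prop :=
  delay_rd_solution tau v T a1 a2 (Omega1 L) -oo e1 /\
  forall t : R, 0 < t < T -> e1 L t = h t.

Definition neumann_solution (R : realType) (tau v T L a1 a2 : R)
    (e1 e2 : R -> R -> R) : Prop :=
  delay_rd_solution tau v T a1 a2 (Omega2 L) +oo e2 /\
  forall t : R, 0 < t < T -> dx (Omega2 L) e2 L t = dx (Omega1 L) e1 L t.

(* [e1 k] and [e2 k] are iterates for [k >= 1] only ([e1 0], [e2 0] are
   unused); [h 0] is the initial interface error. *)
Record dnwr (R : realType) (tau v T L a1 a2 theta : R) (h0 : R -> R)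
    (e1 e2 : nat -> R -> R -> R) (h : nat -> R -> R) : Prop := DNWR {
  dnwr_init : forall t : R, 0 <= t <= T -> h 0%N t = h0 t;
  dnwr_dirichlet : forall k : nat,
    dirichlet_solution tau v T L a1 a2 (h k) (e1 k.+1);
  dnwr_neumann : forall k : nat,
    neumann_solution tau v T L a1 a2 (e1 k.+1) (e2 k.+1);
  dnwr_update : forall (k : nat) (t : R), 0 <= t <= T ->
    h k.+1 t = theta * e2 k.+1 L t + (1 - theta) * h k t
}.

Definition admissible (R : realType) (tau v T L a1 a2 theta : R)
    (h0 : R -> R) : Prop :=
  {within `[0, T]%classic, continuous h0} /\
  exists (e1 e2 : nat -> R -> R -> R) (h : nat -> R -> R),
    dnwr tau v T L a1 a2 theta h0 e1 e2 h.

Definition sup_norm (R : realType) (T : R) (h : R -> R) : R :=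
  sup [set `|h t| | t in `[0, T]%classic].

Definition nonzero_on (R : realType) (T : R) (h : R -> R) : Prop :=
  exists2 t : R, 0 <= t <= T & h t != 0.

(* Uniqueness of the iterates is not presupposed: the rate depends on [h0] only
   and the conclusion is required of every family of iterates issued from
   [h0]. *)
Definition converges_linearly (R : realType) (tau v T L a1 a2 theta : R) :
    Prop :=
  forall h0 : R -> R, admissible tau v T L a1 a2 theta h0 ->
    nonzero_on T h0 ->
    exists2 rho : R, 0 < rho < 1 &
      forall (e1 e2 : nat -> R -> R -> R) (h : nat -> R -> R),
        dnwr tau v T L a1 a2 theta h0 e1 e2 h ->
        (forall k : nat, nonzero_on T (h k)) /\
        (sup_norm T (h k.+1) / sup_norm T (h k)) @[k --> \oo] --> rho.

Definition converges_within_two_iterations (R : realType)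
    (tau v T L a1 a2 theta : R) : Prop :=
  forall h0 : R -> R, admissible tau v T L a1 a2 theta h0 ->
    forall (e1 e2 : nat -> R -> R -> R) (h : nat -> R -> R),
      dnwr tau v T L a1 a2 theta h0 e1 e2 h ->
      forall k : nat, (2 <= k)%N ->
        [/\ forall x t : R, closure (Omega1 L) x -> - tau <= t <= T ->
              e1 k x t = 0,
            forall x t : R, closure (Omega2 L) x -> - tau <= t <= T ->
              e2 k x t = 0
          & forall t : R, 0 <= t <= T -> h k t = 0].

(* Main.v *)
(* If e solves the homogeneous delay equation on x < L, its mirror image
   (x, t) |-> e (2 L - x) t solves it on x > L with the opposite normal
   derivative at L.  Uniqueness for the Neumann problem therefore forces
   e2 = - (mirror image of e1), so that the interface update reads
   h_{k+1} = (1 - 2 theta) h_k.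

   Uniqueness comes from a maximum principle for exp (- lam t) w: once
   lam > |a1| + 2 |a2| the zeroth order and delay terms are dominated at an
   interior maximum, and adding eps (x - L) keeps the maximum off the boundary
   x = L, whether w or its normal derivative vanishes there. *)
Require Import Defs.
From mathcomp Require Import all_boot all_order all_algebra.
From mathcomp Require Import all_classical all_reals all_analysis.
From mathcomp Require Import ring lra.
Import Order.TTheory GRing.Theory Num.Theory.
Import numFieldNormedType.Exports.

Set Implicit Arguments.
Unset Strict Implicit.
Unset Printing Implicit Defensive.

Local Open Scope classical_set_scope.
Local Open Scope ring_scope.

(** * One-variable calculus: difference quotients, closures of half-lines, derivative tests at a
    maximum *)

Section DifferenceQuotients.
Context {R : realType}.
Implicit Types (f : R -> R) (x d c a : R).

Lemma cvg_shift_dnbhs {U : Type} (g : R -> U) x :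
  (fun h => g (h + x)) @ 0^' = g @ x^'.
Proof.
apply/seteqP; split => P /=.
  rewrite /fmap /= /nbhs /= => /= P0.
  have : \forall h \near (0 : R), h != 0 -> P (g (h + x)) by [].
  rewrite (near_shift x) /= => H.
  change (\forall y \near x, y != x -> P (g y)); near=> y => yx.
  have Hy : y + (0 - x) != 0 -> P (g (y + (0 - x) + x)) by near: y; exact: H.
  by move: Hy; rewrite sub0r subrK subr_eq0; exact.
rewrite /fmap /= /nbhs /= => /= P0.
have : \forall h \near x, h != x -> P (g h) by [].
rewrite (near_shift (0 : R)) /= => H.
change (\forall h \near (0 : R), h != 0 -> P (g (h + x))); near=> y => y0.
have Hy : y + (x - 0) != x -> P (g (y + (x - 0))) by near: y; exact: H.
by move: Hy; rewrite subr0 -subr_eq0 addrK; exact.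
Unshelve. all: by end_near. Qed.

(** Bridge between limits in the moving point [y], used for relative derivatives, and the increment
    form [h] at 0 behind [is_derive]. The two filters are translates of each other. *)
Lemma diff_quotient_cvgP f x d :
  diff_quotient f x y @[y --> x^'] --> d <-> is_derive x 1 f d.
Proof.
have E : (fun h => h^-1 *: ((f \o shift x) (h *: 1) - f x)) @ 0^' =
         diff_quotient f x y @[y --> x^'].
  rewrite -cvg_shift_dnbhs.
  suff -> : (fun h => h^-1 *: ((f \o shift x) (h *: 1) - f x)) =
            (fun h => diff_quotient f x (h + x)) by [].
  by apply/funext => h /=; rewrite /diff_quotient addrK [h%:A]mulr1 mulrC.
split=> [fd|[df fd]].
  split; first by rewrite /derivable E; apply/cvg_ex; exists d.
  by rewrite /derive E; apply: cvg_lim.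
by rewrite -fd -E.
Qed.

Lemma closure_Omega2 (L : R) : closure (Omega2 L) = `[L, +oo[%classic.
Proof.
apply/seteqP; split => x /=.
  rewrite in_itv /= andbT => clx; rewrite leNgt; apply/negP => xL.
  have [y []] := clx _ (lt_nbhsl xL).
  by rewrite /Omega2 /= in_itv /= andbT => /lt_trans Ly /Ly; rewrite ltxx.
rewrite in_itv /= andbT => Lx B Bx.
have : \forall y \near x^'+, x < y /\ B y.
  near=> y; split; [by near: y; exact: nbhs_right_gt|].
  by near: y; exact: cvg_within.
move=> /filter_ex[y [xy By]]; exists y; split => //.
by rewrite /Omega2 /= in_itv /= andbT (le_lt_trans Lx).
Unshelve. all: by end_near. Qed.

Lemma closure_Omega1 (L : R) : closure (Omega1 L) = `]-oo, L]%classic.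
Proof.
apply/seteqP; split => x /=.
  rewrite in_itv /= => clx; rewrite leNgt; apply/negP => xL.
  have [y []] := clx _ (lt_nbhsr xL).
  by rewrite /Omega1 /= in_itv /= => yL /lt_trans /(_ yL); rewrite ltxx.
rewrite in_itv /= => Lx B Bx.
have : \forall y \near x^'-, y < x /\ B y.
  near=> y; split; [by near: y; exact: nbhs_left_lt|].
  by near: y; exact: cvg_within.
move=> /filter_ex[y [xy By]]; exists y; split => //.
by rewrite /Omega1 /= in_itv /= (lt_le_trans xy).
Unshelve. all: by end_near. Qed.

Lemma is_derive_derive1 f x : derivable f x 1 -> is_derive x 1 f (derive1 f x).
Proof. by move=> df; split; rewrite ?derive1E. Qed.

(** Near an interior point every [y] lies in [D], so restricting the difference quotient to [D] does
    not change its limit. *)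
Lemma derivable_within_interior (D : set R) f x :
  nbhs x D -> derivable_within D f x -> is_derive x 1 f (derive1 f x).
Proof.
move=> Dx /cvg_ex[d fd]; suff [df _] : is_derive x 1 f d.
  exact: is_derive_derive1.
apply/diff_quotient_cvgP; apply: cvg_trans fd => P xP.
change (\forall y \near x^', P (diff_quotient f x y)); near=> y.
have : D y -> P (diff_quotient f x y) by near: y; exact: xP.
by apply; near: y; exact: cvg_within.
Unshelve. all: by end_near. Qed.

(** The difference quotient keeps the sign of its limit close to [x]. The comparison is with [f x]
    alone, as the derivative is known at that single point. *)
Lemma is_derive_gt0_near f x d : is_derive x 1 f d -> 0 < d ->
  \forall y \near x, (x < y -> f x < f y) /\ (y < x -> f y < f x).
Proof.
move=> /diff_quotient_cvgP fd d0.
have H : \forall y \near x, y != x -> 0 < diff_quotient f x y.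
  exact: cvgr_gt fd _ d0.
near=> y.
have Hy : y != x -> 0 < diff_quotient f x y by near: y.
split=> xy; move: Hy; rewrite /diff_quotient.
  by rewrite gt_eqF// pmulr_lgt0 ?invr_gt0 ?subr_gt0//; apply.
by rewrite lt_eqF// nmulr_lgt0 ?invr_lt0 ?subr_lt0//; apply.
Unshelve. all: by end_near. Qed.

(** One-sided on purpose: in time, the maximum may sit at the final instant of the rectangle, where
    only earlier times can be compared. *)
Lemma is_derive_left_max_ge0 f (a x d : R) : a < x -> is_derive x 1 f d ->
  (forall y, a < y < x -> f y <= f x) -> 0 <= d.
Proof.
move=> ax fd fmax; rewrite leNgt; apply/negP => d0.
have Nfd : is_derive x 1 (- f) (- d) by exact: is_deriveN.
have near_x := is_derive_gt0_near Nfd; rewrite oppr_gt0 in near_x.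
have : \forall y \near x^'-, a < y < x /\ f x < f y.
  near=> y.
  have yx : y < x by near: y; exact: nbhs_left_lt.
  split; first by rewrite yx andbT; near: y; exact: nbhs_left_gt.
  have /(_ yx) : y < x -> - f y < - f x.
    by near: y; apply: cvg_within; apply: filterS (near_x d0) => y [].
  by rewrite ltrN2.
by move=> /filter_ex[y [/fmax]]; rewrite leNgt => /negP.
Unshelve. all: by end_near. Qed.

(** At the maximum [p] vanishes. If [q] were positive, [p] would be positive just to the right of
    [x], and the mean value theorem would make [f] exceed its maximum there. *)
Lemma second_derivative_le0_at_max f (p : R -> R) (a b x q : R) : a < x < b ->
  (forall y, a < y < b -> is_derive y 1 f (p y)) -> is_derive x 1 p q ->
  (forall y, a < y < b -> f y <= f x) -> q <= 0.
Proof.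
move=> axb fp pq fmax; have /andP[ax xb] := axb.
have p0 : p x = 0.
  have xab : x \in `]a, b[%R by rewrite in_itv /= axb.
  have fx0 : is_derive x 1 f 0.
    apply: (@derive1_at_max _ f a b) xab _ => [|t|t]; rewrite ?in_itv/=.
    - exact: ltW (lt_trans ax xb).
    - by move=> /fp[].
    - exact: fmax.
  have fx := fp _ axb; rewrite -(@derive_val _ _ _ _ _ _ _ fx).
  by rewrite (@derive_val _ _ _ _ _ _ _ fx0).
rewrite leNgt; apply/negP => q0.
have /nbhs_ballP[e /= e0 xe] := is_derive_gt0_near pq q0.
(* This [y] stays below [b] and within [e / 2] of [x], so the mean value point between [x] and [y]
   falls in the ball where [p] is positive. *)
pose y := Num.min (x + e / 2) ((x + b) / 2).
have [xy yb ye] : [/\ x < y, y < b & y <= x + e / 2].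
  rewrite /y minEle; case: ifP => [|/negbT]; rewrite -?ltNge => ?; split; lra.
have in_ab z : z \in `[x, y]%R -> a < z < b by rewrite in_itv /=; lra.
have [c] : exists2 c, c \in `]x, y[%R & f y - f x = p c * (y - x).
  apply: MVT => // [z|]; first by rewrite in_itv /= => zxy; apply: fp; lra.
  by apply: derivable_within_continuous => z /in_ab /fp[].
rewrite in_itv /= => /andP[xc cy] fyx.
have pc : 0 < p c.
  have [] := xe c; last by move=> /(_ xc); rewrite p0.
  by rewrite /ball /= ler0_norm; lra.
have : f y <= f x by apply: fmax; lra.
rewrite -subr_le0 fyx pmulr_rle0 //; lra.
Qed.

Lemma is_derive_cst_mul f x d c :
  is_derive x 1 f d -> is_derive x 1 (fun y => c * f y) (c * d).
Proof. by move=> fd; exact: (is_deriveZ c). Qed.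

Lemma is_derive_cst_add f x d c :
  is_derive x 1 f d -> is_derive x 1 (fun y => f y + c) d.
Proof.
move=> fd; rewrite -[d]addr0.
exact: (is_deriveD fd (is_derive_cst c x 1)).
Qed.

Lemma is_derive_linear c a x : is_derive x 1 (fun y => c * (y - a)) c.
Proof.
rewrite -[X in is_derive _ _ _ X]mulr1; apply: is_derive_cst_mul.
exact: is_derive_cst_add.
Qed.

Lemma is_derive_expR_mul f x d c : is_derive x 1 f d ->
  is_derive x 1 (fun y => expR (c * y) * f y) (expR (c * x) * (d + c * f x)).
Proof.
move=> fd.
have cd : is_derive x 1 (fun y => c * y) (c * 1).
  exact: is_derive_cst_mul.
have ed : is_derive x 1 (fun y => expR (c * y)) (expR (c * x) * (c * 1)).
  by apply: (@is_derive1_comp _ expR).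
have := is_deriveM ed fd.
rewrite (_ : _ + _ = expR (c * x) * (d + c * f x)) //.
by rewrite -[f x *: _]/(f x * _) -[_ *: d]/(_ * d); ring.
Qed.

Lemma cvg_pair_nbhs {I : Type} (F : set_system I) {FF : Filter F}
    (g h : I -> R) (a b : R) :
  g @ F --> a -> h @ F --> b -> (g i, h i) @[i --> F] --> ((a, b) : R * R).
Proof. exact: (@cvg_pair I R R F (nbhs a) (nbhs b)). Qed.

End DifferenceQuotients.

(** * Reduction of both subdomain problems to the half-line [L < x] *)

Section HalfLine.
Context {R : realType}.
Implicit Types (tau v T a L lam x t X : R) (w e : R -> R -> R).

(* A common weakening of the solutions on both subdomains, the one on
   x < L being read through the reflection x |-> 2 L - x. *)
Record half_line_solution tau v T a1 a2 L w : Prop := HalfLineSolution {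
  half_line_cont : forall X, {within `[L, X] `*` `[- tau, T]%classic,
    continuous (fun z : R * R => w z.1 z.2)};
  half_line_pde : exists p q r : R -> R -> R, forall x t, L < x -> 0 < t < T ->
    [/\ is_derive x 1 (w ^~ t) (p x t), is_derive x 1 (p ^~ t) (q x t),
        is_derive t 1 (w x) (r x t) &
        r x t - v ^+ 2 * q x t + a1 * w x t + a2 * w x (t - tau) = 0];
  half_line_history : forall x t, L < x -> - tau <= t <= 0 -> w x t = 0;
  half_line_infinity : vanishes_at T +oo w
}.

Arguments half_line_cont {tau v T a1 a2 L w}.

Lemma half_line_solutionD tau v T a1 a2 L w1 w2 :
  half_line_solution tau v T a1 a2 L w1 ->
  half_line_solution tau v T a1 a2 L w2 ->
  half_line_solution tau v T a1 a2 L (fun x t => w1 x t + w2 x t).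
Proof.
move=> [c1 [p1 [q1 [r1 d1]]] h1 v1] [c2 [p2 [q2 [r2 d2]]] h2 v2]; split.
- by move=> X z; apply: cvgD; [exact: c1|exact: c2].
- exists (fun x t => p1 x t + p2 x t), (fun x t => q1 x t + q2 x t),
    (fun x t => r1 x t + r2 x t) => x t Lx tT.
  have [w1p p1q w1r pde1] := d1 _ _ Lx tT.
  have [w2p p2q w2r pde2] := d2 _ _ Lx tT.
  split; [exact: is_deriveD|exact: is_deriveD|exact: is_deriveD|].
  by rewrite -[RHS](addr0 0) -{1}pde1 -pde2; ring.
- by move=> x t Lx tt; rewrite h1 ?h2 ?addr0.
- move=> eps eps0; have eps2 : 0 < eps / 2 by rewrite divr_gt0.
  have {}v1 := v1 _ eps2; have {}v2 := v2 _ eps2; near=> x => t tT.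
  rewrite (splitr eps) (le_lt_trans (ler_normD _ _))// ltrD//.
    by move: t tT; near: x.
  by move: t tT; near: x.
Unshelve. all: by end_near. Qed.

Lemma half_line_solutionN tau v T a1 a2 L w :
  half_line_solution tau v T a1 a2 L w ->
  half_line_solution tau v T a1 a2 L (fun x t => - w x t).
Proof.
move=> [cw [p [q [r dw]]] hw vw]; split.
- by move=> X z; apply: cvgN; exact: cw.
- exists (fun x t => - p x t), (fun x t => - q x t), (fun x t => - r x t).
  move=> x t Lx tT; have [wp pq wr pde] := dw _ _ Lx tT.
  split; [exact: is_deriveN|exact: is_deriveN|exact: is_deriveN|].
  by rewrite -[RHS]oppr0 -pde; ring.
- by move=> x t Lx tt; rewrite hw ?oppr0.
- move=> eps /vw; apply: filterS => x + t tT.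
  by rewrite normrN; exact.
Qed.

(** Regularity in [x] is stated relative to [closure O] at first order and through [derive1] at
    second order. On the open set [O] the two notions agree, which yields a chain of ordinary
    derivatives. *)
Lemma classical_interior tau v T a1 a2 (O : set R) (F : set_system R) e :
  open O -> delay_rd_solution tau v T a1 a2 O F e ->
  forall x t, O x -> 0 < t < T ->
    [/\ is_derive x 1 (e ^~ t) (derive1 (e ^~ t) x),
        is_derive x 1 (derive1 (e ^~ t)) (dxx e x t) &
        is_derive t 1 (e x) (dt e x t)].
Proof.
move=> oO [ce _ _ _] x t Ox tT.
have /andP[t0 t1] := tT; split.
- apply: derivable_within_interior (classical_dx ce _ _).
  + by apply: filterS (open_nbhs_nbhs (conj oO Ox)); exact: subset_closure.
  + exact: subset_closure.
  + by rewrite !ltW.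
- exact: is_derive_derive1 (classical_dxx ce Ox tT).
- exact: is_derive_derive1 (classical_dt ce Ox tT).
Qed.

Lemma half_line_Omega2 tau v T a1 a2 L e :
  delay_rd_solution tau v T a1 a2 (Omega2 L) +oo e ->
  half_line_solution tau v T a1 a2 L e.
Proof.
move=> se; have [ce pde he ve] := se.
have oO : open (Omega2 L) by exact: interval_open.
have O2 x : L < x -> Omega2 L x by rewrite /Omega2 /= in_itv /= andbT.
split => //.
- move=> X; apply: continuous_subspaceW (classical_cont ce) => -[x t] /=.
  by rewrite closure_Omega2 /= !in_itv /= => -[/andP[-> _] ->].
- exists (fun x t => derive1 (e ^~ t) x), (dxx e), (dt e) => x t /O2 Ox tT.
  have [ep pq er] := classical_interior oO se Ox tT.
  by split => //; exact: pde.
- by move=> x t /O2 Ox; exact: he.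
Qed.

Lemma half_line_Omega1 tau v T a1 a2 L e :
  delay_rd_solution tau v T a1 a2 (Omega1 L) -oo e ->
  half_line_solution tau v T a1 a2 L (fun x t => e (2 * L - x) t).
Proof.
move=> se; have [ce pde he ve] := se.
have oO : open (Omega1 L) by exact: interval_open.
have O1 x : L < x -> Omega1 L (2 * L - x) by rewrite /Omega1 /= in_itv /=; lra.
have reflect_derive (f : R -> R) x d : is_derive (2 * L - x) 1 f d ->
    is_derive x 1 (fun y => f (2 * L - y)) (- d).
  move=> fd; rewrite -mulrN1.
  have gd : is_derive x 1 (fun y => 2 * L - y) (- 1).
    by rewrite -[- 1]add0r; apply: is_deriveD; exact: is_deriveNid.
  exact: is_derive1_comp.
split => //.
- move=> X; apply/subspace_continuousP => -[x t] /= [].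
  rewrite !in_itv /= => /andP[Lx _] tT.
  have /subspace_continuousP := classical_cont ce.
  move=> /(_ (2 * L - x, t)); rewrite closure_Omega1 /= !in_itv /= => cex.
  have xtA : 2 * L - x <= L /\ - tau <= t <= T by split=> //; lra.
  have reflect_cvg : (2 * L - z.1, z.2) @[z --> (x, t)] --> (2 * L - x, t).
    apply: cvg_pair_nbhs; last exact: cvg_snd.
    by apply: cvgB; [exact: cvg_cst|exact: cvg_fst].
  apply: cvg_trans (cex xtA) => P eP.
  have {}eP : \forall z \near ((2 * L - x, t) : R * R),
      (`]-oo, L] `*` `[- tau, T]) z -> P (e z.1 z.2) by exact: eP.
  change (\forall z \near ((x, t) : R * R),
    (`[L, X] `*` `[- tau, T]) z -> P (e (2 * L - z.1) z.2)).
  near=> z => -[]; rewrite /= !in_itv /= => /andP[Lz _] zT.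
  have : (`]-oo, L] `*` `[- tau, T]) (2 * L - z.1, z.2) ->
      P (e (2 * L - z.1) z.2) by near: z; exact: reflect_cvg _ eP.
  by apply; rewrite /= !in_itv /=; split=> //; lra.
(* Reflection flips the sign of the first space derivative and flips it back for the second, so the
   equation is preserved. *)
- exists (fun x t => - derive1 (e ^~ t) (2 * L - x)),
    (fun x t => dxx e (2 * L - x) t), (fun x t => dt e (2 * L - x) t).
  move=> x t /O1 Ox tT.
  have [ep pq er] := classical_interior oO se Ox tT.
  split => //; last exact: pde.
  + exact: reflect_derive ep.
  + by rewrite -[dxx e _ t]opprK; apply: is_deriveN; exact: reflect_derive pq.
- by move=> x t /O1 Ox; exact: he.
- move=> eps /ve[M [Mreal eM]]; exists (2 * L - M); split; first exact: num_real.
  by move=> x Mx t tT; apply: eM tT; lra.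
Unshelve. all: by end_near. Qed.

(** A nonzero value at [z] would persist at nearby points of [A], in particular along [g]. This
    carries identities from open sets to the boundary point [L] and to the end times 0 and [T]. *)
Lemma within_continuous_eq0 {U : topologicalType} {I : Type}
    (G : set_system I) {PG : ProperFilter G} (A : set U)
    (f : U -> R) (g : I -> U) (z : U) :
  {within A, continuous f} -> A z -> g @ G --> z ->
  (\forall i \near G, A (g i) /\ f (g i) = 0) -> f z = 0.
Proof.
move=> /subspace_continuousP cf Az gz G0; apply/eqP; apply/negPn/negP => fz0.
have near_z : \forall y \near z, A y -> f y != 0.
  exact: (cvgr_neq0 _ (cf _ Az) fz0).
have : \forall i \near G, False.
  have near_gz : \forall i \near G, A (g i) -> f (g i) != 0
    by exact: gz _ near_z.
  by apply: filterS2 near_gz G0 => i /[swap] -[Agi ->] /(_ Agi); rewrite eqxx.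
by move=> /filter_ex[].
Qed.

Lemma half_line_history_closed tau v T a1 a2 L w x t : 0 < T ->
  half_line_solution tau v T a1 a2 L w -> L <= x -> - tau <= t <= 0 -> w x t = 0.
Proof.
move=> T0 w_sol; rewrite le_eqVlt => /orP[/eqP <-{x}|Lx]; last first.
  exact: (half_line_history w_sol Lx).
(* Any right end beyond [L] would do: only points tending to [L] from the right matter. *)
move=> t0; have cw := half_line_cont w_sol (L + 1).
apply: (within_continuous_eq0 (G := L^'+) (g := fun x => (x, t))
  (z := (L, t)) cw) => /=.
- by rewrite !in_itv /=; split; lra.
- by apply: cvg_pair_nbhs; [exact: cvg_within|exact: cvg_cst].
- near=> y.
  have Ly : L < y by near: y; exact: nbhs_right_gt.
  have yL1 : y <= L + 1 by near: y; apply: nbhs_right_le; rewrite ltrDl.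
  split; last exact: (half_line_history w_sol Ly t0).
  by rewrite !in_itv /=; split; lra.
Unshelve. all: by end_near. Qed.

(** * Maximum principle and uniqueness on the half-line *)

Definition weighted lam w x t := expR (- lam * t) * w x t.

Lemma weighted_continuous tau v T a1 a2 L w lam X t1 : 0 < tau -> t1 <= T ->
  half_line_solution tau v T a1 a2 L w ->
  {within `[L, X] `*` `[0, t1]%classic,
    continuous (fun z : R * R => weighted lam w z.1 z.2)}.
Proof.
move=> tau0 t1T w_sol.
have : {within `[L, X] `*` `[- tau, T]%classic,
    continuous (fun z : R * R => weighted lam w z.1 z.2)}.
  move=> z; apply: cvgM; last exact: half_line_cont w_sol _ _.
  apply: continuous_subspaceT => {}z.
  apply: continuous_comp; last exact: continuous_expR.
  by apply: cvgM; [exact: cvg_cst|exact: cvg_snd].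
apply: continuous_subspaceW => -[x t] /=; rewrite !in_itv /= => -[-> ?].
by split=> //; lra.
Qed.

(** The bound is on the absolute value of the weighted function because [a2] has no prescribed sign,
    so the delayed value must be controlled from both sides. The boundary alternative covers
    Dirichlet and Neumann data at once. *)
Lemma no_positive_maximum tau v T a1 a2 L w lam X t1 xs ts :
  0 < tau -> half_line_solution tau v T a1 a2 L w ->
  (forall t, 0 < t < T ->
    w L t = 0 \/ diff_quotient (w ^~ t) L y @[y --> L^'+] --> (0 : R)) ->
  `|a1| + 2 * `|a2| < lam -> L < X -> 0 < t1 < T ->
  L <= xs <= X -> 0 <= ts <= t1 -> 0 < weighted lam w xs ts ->
  (forall x t, L <= x <= X -> 0 <= t <= t1 ->
    `|weighted lam w x t| <= weighted lam w xs ts) ->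
  (forall t, 0 < t <= t1 -> weighted lam w X t < weighted lam w xs ts / 2) ->
  False.
Proof.
move=> tau0 w_sol w_bnd lam_gt LX t1T xsX tst1.
set W := weighted lam w; set M := W xs ts => M0 WM WX.
have T0 : 0 < T by lra.
have history x t : L <= x -> - tau <= t <= 0 -> w x t = 0.
  exact: half_line_history_closed T0 w_sol.
have lam0 : 0 <= lam by apply: le_trans (ltW lam_gt); rewrite addr_ge0 // mulr_ge0.
(* eps (x - L) <= M / 4 on [L, X], so a maximum of W + eps (x - L) has W >= 3 M / 4. *)
pose eps := M / (4 * (X - L)).
have eps0 : 0 < eps by rewrite divr_gt0 // mulr_gt0 // subr_gt0.
have eps_bound x : x <= X -> eps * (x - L) <= M / 4.
  move=> xX; apply: (@le_trans _ _ (eps * (X - L))).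
    by rewrite ler_pM2l //; lra.
  by rewrite le_eqVlt /eps; apply/orP; left; apply/eqP; field; lra.
pose G x t := W x t + eps * (x - L).
pose K : set (R * R) := `[L, X] `*` `[0, t1].
have KE x t : (x, t) \in K = (L <= x <= X) && (0 <= t <= t1).
  by apply/idP/andP; rewrite inE /K /= !in_itv.
have [[x0 t0] ] : exists2 c, c \in K & forall z, z \in K -> G z.1 z.2 <= G c.1 c.2.
  apply: compact_EVT_max.
  - by exists (xs, ts); rewrite /K /= !in_itv.
  - by apply: compact_setX; exact: segment_compact.
  - have cW : {within K, continuous (fun z : R * R => W z.1 z.2)}.
      by apply: weighted_continuous w_sol => //; lra.
    have cl : {within K, continuous (fun z : R * R => eps * (z.1 - L))}.
      apply: continuous_subspaceT => z; apply: cvgM; first exact: cvg_cst.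
      by apply: cvgB; [exact: cvg_fst|exact: cvg_cst].
    by move=> z; apply: cvgD; [exact: cW|exact: cl].
rewrite KE => /andP[x0X t0t1] G_max'.
have G_max x t : L <= x <= X -> 0 <= t <= t1 -> G x t <= G x0 t0.
  by move=> xX tt1; apply: (G_max' (x, t)); rewrite KE xX.
have W_large : 3 / 4 * M <= W x0 t0.
  have : M <= G x0 t0.
    apply: le_trans (G_max xs ts xsX tst1); rewrite /G -/M lerDl.
    by rewrite mulr_ge0 ?subr_ge0 ?(ltW eps0) //; lra.
  have /eps_bound : x0 <= X by lra.
  rewrite /G; lra.
(* The zero history rules out the initial time, and smallness at [X] rules out the far end: both
   contradict [W_large]. *)
have t0_gt0 : 0 < t0.
  rewrite lt_neqAle; apply/andP; split; last by lra.
  apply/eqP => t00; move: W_large; rewrite /W /weighted history ?mulr0; lra.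
have t0T : 0 < t0 < T by lra.
have x0_ltX : x0 < X.
  rewrite lt_neqAle; apply/andP; split; last by lra.
  apply/eqP => x0E; have := WX t0; rewrite -x0E; lra.
have x0_gtL : L < x0.
  rewrite lt_neqAle; apply/andP; split; last by lra.
  apply/eqP => x0E; have [wL|wL] := w_bnd _ t0T.
    by move: W_large; rewrite /W /weighted -x0E wL mulr0; lra.
  (* In the Neumann case the linear term gives [G] the right derivative [eps > 0] at [L], so [G]
     takes larger values just to the right. *)
  have : diff_quotient (G ^~ t0) L y @[y --> L^'+] --> expR (- lam * t0) * 0 + eps.
    have : expR (- lam * t0) * diff_quotient (w ^~ t0) L y + eps @[y --> L^'+]
      --> expR (- lam * t0) * 0 + eps.
      by apply: cvgD; [apply: cvgM; [exact: cvg_cst|]|exact: cvg_cst].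
    apply: cvg_trans; apply: near_eq_cvg; near=> y.
    have Ly : L < y by near: y; exact: nbhs_right_gt.
    by rewrite /diff_quotient /G /W /weighted; field; lra.
  move=> /cvgr_gt /(_ 0); rewrite mulr0 add0r => /(_ eps0) dq_pos.
  have : \forall y \near L^'+, False.
    near=> y.
    have Ly : L < y by near: y; exact: nbhs_right_gt.
    have yX : y < X by near: y; exact: nbhs_right_lt.
    have : 0 < diff_quotient (G ^~ t0) L y by near: y.
    rewrite /diff_quotient pmulr_lgt0 ?invr_gt0 ?subr_gt0 // x0E ltNge.
    by move=> /negP; apply; apply: G_max => //; lra.
  by move=> /filter_ex[].
have [p [q [r dw]]] := half_line_pde w_sol.
pose E := expR (- lam * t0).
have E0 : 0 < E by exact: expR_gt0.
have [wp pq wr pde] := dw _ _ x0_gtL t0T.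
(* The linear perturbation has no second derivative, so the second derivative of [G] is [E * q]. *)
have q_le0 : q x0 t0 <= 0.
  rewrite -(pmulr_rle0 _ E0).
  apply: (@second_derivative_le0_at_max _ (G ^~ t0) (fun x => E * p x t0 + eps) L X x0).
  - by rewrite x0_gtL.
  - move=> y /andP[Ly yX]; have [wy _ _ _] := dw _ _ Ly t0T.
    exact: (is_deriveD (is_derive_cst_mul E wy) (is_derive_linear eps L y)).
  - by apply: is_derive_cst_add; exact: is_derive_cst_mul.
  - by move=> y yX; apply: G_max; lra.
have r_ge : lam * w x0 t0 <= r x0 t0.
  have dG : is_derive t0 1 (G x0) (E * (r x0 t0 + - lam * w x0 t0)).
    by apply: is_derive_cst_add; exact: is_derive_expR_mul.
  have := is_derive_left_max_ge0 t0_gt0 dG.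
  rewrite pmulr_rge0 // mulNr subr_ge0; apply => y yt0.
  by apply: G_max; lra.
have delay_le : `|E * w x0 (t0 - tau)| <= M.
  have [t0tau|t0tau] := leP (t0 - tau) 0.
    have -> : w x0 (t0 - tau) = 0 by apply: history; lra.
    by rewrite mulr0 normr0 ltW.
  (* The weight at [t0] is the weight at the delayed time multiplied by a factor at most 1, which
     leaves a weighted value bounded by [M]. *)
  have -> : E = expR (- lam * tau) * expR (- lam * (t0 - tau)).
    by rewrite -expRD /E; congr expR; ring.
  rewrite -mulrA normrM -[leRHS]mul1r ler_pM ?normr_ge0//; last by apply: WM; lra.
  rewrite ger0_norm ?expR_ge0 // -[leRHS]expR0 ler_expR mulNr oppr_le0.
  by rewrite mulr_ge0 // ltW.
have W0 : 0 < W x0 t0 by lra.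
(* This is the equation at the maximum multiplied by [E], with the signs of [q] and of the time
   derivative inserted. *)
have : lam * W x0 t0 <= `|a1| * W x0 t0 + `|a2| * M.
  have h1 : lam * W x0 t0 <= E * r x0 t0.
    by rewrite /W /weighted mulrCA ler_pM2l.
  have h2 : E * r x0 t0 = v ^+ 2 * (E * q x0 t0) - a1 * W x0 t0
      - a2 * (E * w x0 (t0 - tau)).
    by rewrite -[LHS]subr0 -[X in _ - X](mulr0 E) -pde /W /weighted -/E; ring.
  have h3 : v ^+ 2 * (E * q x0 t0) <= 0.
    by rewrite mulr_ge0_le0 ?sqr_ge0 // pmulr_rle0.
  have h4 : - (a1 * W x0 t0) <= `|a1| * W x0 t0.
    by rewrite -mulNr ler_pM2r // -normrN ler_norm.
  have h5 : - (a2 * (E * w x0 (t0 - tau))) <= `|a2| * M.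
    rewrite (le_trans (ler_norm _)) // normrN normrM ler_wpM2l //.
  lra.
(* From [W_large], [M] is at most 4/3 of [W x0 t0], hence below twice it. This is where the 2 in
   front of [|a2|] in the bound on [lam] is spent. *)
have : 0 <= `|a2| * (W x0 t0 - 3 / 4 * M) by rewrite mulr_ge0 // subr_ge0.
have : 0 <= `|a2| * M by rewrite mulr_ge0 // ltW.
have : (`|a1| + 2 * `|a2|) * W x0 t0 < lam * W x0 t0 by rewrite ltr_pM2r.
lra.
Unshelve. all: by end_near. Qed.

Lemma weightedN lam w x t :
  weighted lam (fun x t => - w x t) x t = - weighted lam w x t.
Proof. by rewrite /weighted mulrN. Qed.

Lemma diff_quotientN (f : R -> R) x y :
  diff_quotient (fun z => - f z) x y = - diff_quotient f x y.
Proof. by rewrite /diff_quotient -opprD mulNr. Qed.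

(** A nonzero value would produce a positive maximum of the weighted [w] or of its opposite on a
    compact rectangle, which [no_positive_maximum] excludes. *)
Lemma half_line_solution_eq0 tau v T a1 a2 L w : 0 < tau -> 0 < T ->
  half_line_solution tau v T a1 a2 L w ->
  (forall t, 0 < t < T ->
    w L t = 0 \/ diff_quotient (w ^~ t) L y @[y --> L^'+] --> (0 : R)) ->
  forall x t, L <= x -> - tau <= t <= T -> w x t = 0.
Proof.
move=> tau0 T0 w_sol w_bnd.
(* Times are first kept strictly below [T], so that the equation still holds if the maximum occurs
   at the last instant [t1]. *)
have w_eq0 x1 t1 : L <= x1 -> 0 < t1 < T -> w x1 t1 = 0.
  move=> Lx1 t1T; apply/eqP/negPn/negP => w_neq0.
  pose lam := `|a1| + 2 * `|a2| + 1.
  have lam_gt : `|a1| + 2 * `|a2| < lam by rewrite ltrDl.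
  have lam0 : 0 <= lam by rewrite !addr_ge0 // mulr_ge0.
  pose m := `|weighted lam w x1 t1|.
  have m0 : 0 < m by rewrite normr_gt0 mulf_neq0 // gt_eqF // expR_gt0.
  have m20 : 0 < m / 2 by rewrite divr_gt0.
  (* Decay uniform in time lets one [X] serve all times. The threshold [m / 2] keeps the side
     [x = X] below half of the maximum. *)
  have [X [x1X wX]] : exists X, x1 < X /\ forall t, 0 < t < T -> `|w X t| < m / 2.
    apply: (@filter_ex _ (+oo%R : set_system R)).
    near=> X; split; first by near: X; apply: nbhs_pinfty_gt; exact: num_real.
    by near: X; exact: half_line_infinity w_sol _ m20.
  pose K : set (R * R) := `[L, X] `*` `[0, t1].
  have KE x t : (x, t) \in K = (L <= x <= X) && (0 <= t <= t1).
    by apply/idP/andP; rewrite inE /K /= !in_itv.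
  have [[xs ts]] : exists2 c, c \in K &
      forall z, z \in K -> `|weighted lam w z.1 z.2| <= `|weighted lam w c.1 c.2|.
    apply: compact_EVT_max.
    - by exists (x1, t1); rewrite /K /= !in_itv /=; split; lra.
    - by apply: compact_setX; exact: segment_compact.
    - have cW : {within K, continuous (fun z : R * R => weighted lam w z.1 z.2)}.
        by apply: weighted_continuous w_sol => //; lra.
      by move=> z; apply: cvg_norm; exact: cW.
  rewrite KE => /andP[xsX tst1] W_max'.
  set M := `|weighted lam w xs ts|.
  have W_max x t : L <= x <= X -> 0 <= t <= t1 -> `|weighted lam w x t| <= M.
    by move=> xX tt1; apply: (W_max' (x, t)); rewrite KE xX.
  have mM : m <= M by apply: W_max; lra.
  have W_X t : 0 < t <= t1 -> `|weighted lam w X t| < M / 2.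
    move=> tt1; apply: (@le_lt_trans _ _ `|w X t|).
      rewrite normrM -[leRHS]mul1r ler_wpM2r // ger0_norm ?expR_ge0 //.
      rewrite -[leRHS]expR0 ler_expR mulNr oppr_le0 mulr_ge0 //; lra.
    have : `|w X t| < m / 2 by apply: wX; lra.
    lra.
  (* The maximum of the absolute value is attained with one sign; a negative value is handled by
     passing to [- w]. *)
  have [W0|W0] := leP 0 (weighted lam w xs ts).
    have ME : M = weighted lam w xs ts by rewrite /M ger0_norm.
    rewrite ME in mM W_max W_X.
    apply: (no_positive_maximum tau0 w_sol w_bnd lam_gt _ t1T xsX tst1) W_max _; try lra.
    by move=> t /W_X; apply: le_lt_trans; exact: ler_norm.
  have ME : M = weighted lam (fun x t => - w x t) xs ts.
    by rewrite weightedN /M ltr0_norm.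
  rewrite ME in mM W_max W_X.
  apply: (no_positive_maximum tau0 (half_line_solutionN w_sol) _
    lam_gt _ t1T xsX tst1); try lra.
  - move=> t /w_bnd[->|wL]; [by left; rewrite oppr0|right].
    under eq_fun do rewrite diff_quotientN.
    by rewrite -oppr0; exact: cvgN.
  - by move=> x t xX tt1; rewrite weightedN normrN; exact: W_max.
  - move=> t /W_X; apply: le_lt_trans; rewrite weightedN.
    by rewrite -normrN; exact: ler_norm.
(* Remaining times: the history for [t <= 0], and continuity from the left at [t = T]. *)
move=> x t Lx tT; have [t0|t0] := leP t 0.
  by apply: half_line_history_closed w_sol _ _ => //; lra.
have [tltT|Tt] := ltP t T; first by apply: w_eq0 => //; lra.
have -> : t = T by lra.
have cw := half_line_cont w_sol x.
apply: (within_continuous_eq0 (G := T^'-) (g := fun s => (x, s)) (z := (x, T)) cw).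
- by rewrite /= !in_itv /=; split; lra.
- by apply: cvg_pair_nbhs; [exact: cvg_cst|exact: cvg_within].
- near=> s.
  have s0 : 0 < s by near: s; exact: nbhs_left_gt.
  have sT : s < T by near: s; exact: nbhs_left_lt.
  split; last by apply: w_eq0 => //; rewrite s0.
  rewrite /= !in_itv /= Lx lexx (ltW sT) andbT; split => //.
  by rewrite (le_trans _ (ltW s0)) // oppr_le0 ltW.
Unshelve. all: by end_near. Qed.

(** * One-sided derivatives at the interface and the reflection identity *)

Lemma derive_within_right (f : R -> R) L : derivable_within `[L, +oo[ f L ->
  diff_quotient f L y @[y --> L^'+] --> derive_within `[L, +oo[ f L.
Proof.
move=> df; apply: cvg_trans df => P dP.
have {}dP : \forall y \near L, y != L -> L <= y -> P (diff_quotient f L y).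
  have {}dP : \forall y \near L, y != L -> `[L, +oo[%classic y ->
    P (diff_quotient f L y) by exact: dP.
  near=> y => yL Ly; have : `[L, +oo[%classic y -> P (diff_quotient f L y).
    by move: yL; near: y.
  by apply; rewrite /= in_itv /= Ly.
change (\forall y \near L^'+, P (diff_quotient f L y)); near=> y.
have Ly : L < y by near: y; exact: nbhs_right_gt.
have : y != L -> L <= y -> P (diff_quotient f L y) by near: y; exact: cvg_within.
by apply; [rewrite gt_eqF|exact: ltW].
Unshelve. all: by end_near. Qed.

(** Reflection about [L] fixes [L] and turns left difference quotients into right ones with opposite
    sign. *)
Lemma derive_within_left_reflect (f : R -> R) L :
  derivable_within `]-oo, L] f L ->
  diff_quotient (fun y => f (2 * L - y)) L y @[y --> L^'+]
    --> - derive_within `]-oo, L] f L.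
Proof.
move=> df.
have E : - diff_quotient f L (2 * L - y) @[y --> L^'+]
    --> - derive_within `]-oo, L] f L.
  apply: cvgN; apply: cvg_trans df => P dP.
  have {}dP : \forall y \near L, y != L -> `]-oo, L]%classic y ->
    P (diff_quotient f L y) by exact: dP.
  have reflectL : 2 * L - y @[y --> L^'+] --> L.
    rewrite [X in _ --> X](_ : L = 2 * L - L); last by ring.
    by apply: cvgB; [exact: cvg_cst|exact: cvg_within].
  change (\forall y \near L^'+, P (diff_quotient f L (2 * L - y))); near=> y.
  have Ly : L < y by near: y; exact: nbhs_right_gt.
  have : 2 * L - y != L -> `]-oo, L]%classic (2 * L - y) ->
    P (diff_quotient f L (2 * L - y)) by near: y; exact: reflectL _ dP.
  by apply; [rewrite lt_eqF //; lra|rewrite /= in_itv /=; lra].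
apply: cvg_trans E; apply: near_eq_cvg; near=> y.
have Ly : L < y by near: y; exact: nbhs_right_gt.
rewrite /diff_quotient (_ : 2 * L - L = L); last by ring.
by field; rewrite !subr_eq0 gt_eqF // lt_eqF //; lra.
Unshelve. all: by end_near. Qed.

(** The sum of [e2] and the mirror image of [e1] solves the half-line problem, and its right
    derivative at [L] is the difference of the two matched fluxes, namely 0. *)
Lemma neumann_reflection tau v T L a1 a2 h e1 e2 : 0 < tau -> 0 < T ->
  dirichlet_solution tau v T L a1 a2 h e1 ->
  neumann_solution tau v T L a1 a2 e1 e2 ->
  forall x t, L <= x -> - tau <= t <= T -> e2 x t = - e1 (2 * L - x) t.
Proof.
move=> tau0 T0 [e1_sol _] [e2_sol dx_eq] x t Lx tT.
apply/eqP; rewrite -addr_eq0; apply/eqP.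
have w_sol := half_line_solutionD (half_line_Omega2 e2_sol)
  (half_line_Omega1 e1_sol).
apply: (half_line_solution_eq0 tau0 T0 w_sol) => // {x Lx tT} {}t tT; right.
have clL1 : closure (Omega1 L) L by rewrite closure_Omega1 /= in_itv /=.
have clL2 : closure (Omega2 L) L by rewrite closure_Omega2 /= in_itv /= lexx.
have tT' : 0 <= t <= T by lra.
have := classical_dx (sol_classical e1_sol) clL1 tT'.
have := classical_dx (sol_classical e2_sol) clL2 tT'.
have := dx_eq _ tT; rewrite /dx closure_Omega1 closure_Omega2 => dE.
move=> /derive_within_right d2 /derive_within_left_reflect d1.
rewrite (_ : diff_quotient _ L = fun y => diff_quotient (e2 ^~ t) L y +
    diff_quotient (fun z => e1 (2 * L - z) t) L y); last first.
  by apply/funext => y; rewrite /diff_quotient /=; ring.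
by rewrite -(subrr (derive_within `[L, +oo[ (e2 ^~ t) L)) {2}dE; exact: cvgD.
Qed.

Lemma dirichlet_eq0 tau v T L a1 a2 h e1 : 0 < tau -> 0 < T ->
  dirichlet_solution tau v T L a1 a2 h e1 ->
  (forall t, 0 < t < T -> h t = 0) ->
  forall x t, x <= L -> - tau <= t <= T -> e1 x t = 0.
Proof.
move=> tau0 T0 [e1_sol e1h] h0 x t xL tT.
rewrite -[x](_ : 2 * L - (2 * L - x) = x); last by ring.
apply: (half_line_solution_eq0 tau0 T0 (half_line_Omega1 e1_sol)) => //.
  move=> s sT; left; rewrite (_ : 2 * L - L = L); last by ring.
  by rewrite e1h ?h0.
lra.
Qed.

(** * Traces on the interface and the recursion for [h] *)

Lemma continuous_trace (D : set (R * R)) e x T :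
  {within D, continuous (fun z : R * R => e z.1 z.2)} ->
  (forall t, 0 <= t <= T -> D (x, t)) ->
  {within `[0, T], continuous (e x)}.
Proof.
move=> /subspace_continuousP ce Dx; apply/subspace_continuousP => t /=.
rewrite in_itv /= => tT; apply: cvg_trans (ce _ (Dx _ tT)) => P eP.
have {}eP : \forall z \near ((x, t) : R * R), D z -> P (e z.1 z.2) by exact: eP.
change (\forall s \near t, `[0, T]%classic s -> P (e x s)).
have xt : (x, s) @[s --> t] --> ((x, t) : R * R).
  by apply: cvg_pair_nbhs; [exact: cvg_cst|exact: cvg_id].
near=> s; rewrite /= in_itv /= => /Dx xs.
have : D (x, s) -> P (e x s) by near: s; exact: xt _ eP.
exact.
Unshelve. all: by end_near. Qed.

(** The Dirichlet condition is imposed on the open time interval, whereas the update and the sup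
    norm live on the closed one. Continuity of both sides supplies the two end times. *)
Lemma dirichlet_trace tau v T L a1 a2 h e1 : 0 < tau -> 0 < T ->
  dirichlet_solution tau v T L a1 a2 h e1 ->
  {within `[0, T], continuous h} ->
  forall t, 0 <= t <= T -> e1 L t = h t.
Proof.
move=> tau0 T0 [e1_sol e1h] ch t tT.
have ce1 : {within `[0, T], continuous (e1 L)}.
  apply: continuous_trace (classical_cont (sol_classical e1_sol)) _ => s sT.
  by rewrite closure_Omega1 /= !in_itv /=; split; lra.
have cd : {within `[0, T], continuous (fun s => e1 L s - h s)}.
  by move=> s; apply: cvgB; [exact: ce1|exact: ch].
apply/eqP; rewrite -subr_eq0; apply/eqP.
have [t0|t0] := ltP 0 t; last first.
  have -> : t = 0 by lra.
  apply: (within_continuous_eq0 (G := 0^'+) (g := id) (z := 0) cd).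
  - by rewrite /= in_itv /=; lra.
  - exact: cvg_within.
  - near=> s.
    have s0 : 0 < s by near: s; exact: nbhs_right_gt.
    have sT : s < T by near: s; exact: nbhs_right_lt.
    by split; [rewrite /= in_itv /=; lra|rewrite e1h ?subrr ?s0].
have [tltT|Tt] := ltP t T; first by rewrite e1h ?subrr ?t0.
have -> : t = T by lra.
apply: (within_continuous_eq0 (G := T^'-) (g := id) (z := T) cd).
- by rewrite /= in_itv /=; lra.
- exact: cvg_within.
- near=> s.
  have s0 : 0 < s by near: s; exact: nbhs_left_gt.
  have sT : s < T by near: s; exact: nbhs_left_lt.
  by split; [rewrite /= in_itv /=; lra|rewrite e1h ?subrr ?s0].
Unshelve. all: by end_near. Qed.

Lemma dnwr_interface tau v T L a1 a2 theta h0 (e1 e2 : nat -> R -> R -> R) h :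
  0 < tau -> 0 < T ->
  dnwr tau v T L a1 a2 theta h0 e1 e2 h -> {within `[0, T], continuous h0} ->
  forall k t, 0 <= t <= T -> h k t = (1 - 2 * theta) ^+ k * h0 t.
Proof.
move=> tau0 T0 [h_init e1_sol e2_sol h_upd] ch0; elim=> [|k IHk] t tT.
  by rewrite expr0 mul1r h_init.
(* Continuity of [h k] is not a field of [dnwr]; it is read off the closed form given by the
   induction hypothesis. *)
have chk : {within `[0, T], continuous (h k)}.
  have : {within `[0, T], continuous (fun t => (1 - 2 * theta) ^+ k * h0 t)}.
    by move=> s; apply: cvgM; [exact: cvg_cst|exact: ch0].
  apply: subspace_eq_continuous => s /set_mem /=; rewrite in_itv /= => sT.
  by rewrite /from_subspace IHk.
have -> : h k.+1 t = (1 - 2 * theta) * h k t.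
  have LT : - tau <= t <= T by lra.
  rewrite h_upd // (neumann_reflection tau0 T0 (e1_sol k) (e2_sol k) (lexx L) LT).
  rewrite (_ : 2 * L - L = L); last by ring.
  by rewrite (dirichlet_trace tau0 T0 (e1_sol k) chk) //; ring.
by rewrite IHk // exprS mulrA.
Qed.

(** * Convergence of the iteration *)

Lemma sup_norm_max T (h : R -> R) (s : R) : 0 <= s <= T ->
  (forall t, 0 <= t <= T -> `|h t| <= `|h s|) -> sup_norm T h = `|h s|.
Proof.
move=> sT hmax; apply/eqP; rewrite eq_le /sup_norm; apply/andP; split.
  apply: ge_sup; first by exists `|h s|, s; rewrite //= in_itv.
  by move=> _ [t /= tT <-]; apply: hmax; move: tT; rewrite in_itv.
apply: ub_le_sup; last by exists s; rewrite //= in_itv.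
by exists `|h s| => _ [t /= tT <-]; apply: hmax; move: tT; rewrite in_itv.
Qed.

(** All iterates are multiples of [h0], so their absolute values peak at the same point [s], and the
    ratio of norms is constantly [|1 - 2 * theta|]. *)
Lemma dnwr_linear tau v T L a1 a2 theta : 0 < tau -> 0 < T ->
  0 < theta < 1 -> theta != 1 / 2 ->
  converges_linearly tau v T L a1 a2 theta.
Proof.
move=> tau0 T0 theta01 theta_neq h0 [ch0 _] [t0 t0T h0t0].
have rho_neq0 : 1 - 2 * theta != 0.
  by apply: contra theta_neq => /eqP rho0; apply/eqP; lra.
exists `|1 - 2 * theta|.
  by rewrite normr_gt0 rho_neq0 /= ltr_norml; apply/andP; split; lra.
move=> e1 e2 h hD; have hE := dnwr_interface tau0 T0 hD ch0.
split=> [k|].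
  by exists t0 => //; rewrite hE // mulf_neq0 // expf_neq0.
have cN : {within `[0, T], continuous (fun t => `|h0 t|)}.
  by move=> t; apply: cvg_norm; exact: ch0.
have [s] := EVT_max (ltW T0) cN; rewrite in_itv /= => sT h0max.
have normE k : sup_norm T (h k) = `|1 - 2 * theta| ^+ k * `|h0 s|.
  rewrite (@sup_norm_max _ _ s) //; first by rewrite hE // normrM normrX.
  move=> t tT; rewrite !hE // !normrM ler_wpM2l //.
  by apply: h0max; rewrite in_itv.
have h0s : 0 < `|h0 s|.
  by apply: lt_le_trans (h0max t0 _); rewrite ?in_itv //= normr_gt0.
rewrite (_ : (fun k => _) = fun=> `|1 - 2 * theta|); first exact: cvg_cst.
apply/funext => k; rewrite !normE exprS -mulrA mulfK //.
by rewrite mulf_neq0 ?gt_eqF // exprn_gt0 // normr_gt0.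
Qed.

Lemma dnwr_two_iterations tau v T L a1 a2 theta : 0 < tau -> 0 < T ->
  theta = 1 / 2 -> converges_within_two_iterations tau v T L a1 a2 theta.
Proof.
(* The iterate [k.+2] has Dirichlet data [h k.+1], which already vanishes: the interface error is
   zero after one update, the subdomain errors from the second iterate on. *)
move=> tau0 T0 theta12 h0 [ch0 _] e1 e2 h hD [//|[//|k]] _.
have h_eq0 n t : 0 <= t <= T -> h n.+1 t = 0.
  move=> tT; rewrite (dnwr_interface tau0 T0 hD ch0) //.
  by rewrite (_ : 1 - 2 * theta = 0) ?expr0n ?mul0r //; lra.
have e1_eq0 x t : x <= L -> - tau <= t <= T -> e1 k.+2 x t = 0.
  move=> xL tT; apply: dirichlet_eq0 (dnwr_dirichlet hD k.+1) _ _ _ _ _ => //.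
  by move=> s sT; apply: h_eq0; lra.
split=> [x t|x t|t].
- by rewrite closure_Omega1 /= in_itv /=; exact: e1_eq0.
- rewrite closure_Omega2 /= in_itv /= andbT => Lx tT.
  rewrite (neumann_reflection tau0 T0 (dnwr_dirichlet hD k.+1)
    (dnwr_neumann hD k.+1)) // e1_eq0 ?oppr0 //; lra.
- exact: h_eq0.
Qed.

End HalfLine.

Theorem theorem1 (R : realType) (tau v T L a1 a2 theta : R)
    (htau : 0 < tau) (hv : 0 < v) (hT : 0 < T) (ha2 : a2 != 0) :
  (0 < theta < 1 -> theta != 1 / 2 ->
     converges_linearly tau v T L a1 a2 theta) /\
  (theta = 1 / 2 ->
     converges_within_two_iterations tau v T L a1 a2 theta).
Proof. by split; [exact: dnwr_linear|exact: dnwr_two_iterations]. Qed.
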